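(* Let $X$ be a uniformly smooth real Banach space whose modulus of smoothness satisfies $\rho(u)\le\gamma u^q$ for all $u>0$, where $1<q\le 2$ and $\gamma>0$, and let $\mathcal{D}$ be a dictionary in $X$. Take a number $\epsilon\ge 0$ and two elements $f,f^\epsilon\in X$ such that $$\|f-f^\epsilon\|\le\epsilon,\qquad f^\epsilon/A(\epsilon)\in A_1(\mathcal{D}),$$ with some number $A(\epsilon)>0$. Let $\tau=\{t_k\}_{k=1}^\infty$ be a sequence of numbers in $[0,1]$, and let $f^{c,\tau}_m$, $\varphi^c_m$, $v_m$ be the residuals, the chosen dictionary elements and the associated numbers of any realization of the Weak Chebyshev Greedy Algorithm with weakness sequence $\tau$ applied to $f$. Then for every $m\ge 1$ for which the $m$th iteration is performed, $$\|f^{c,\tau}_m\|\le\max\left\{2\epsilon,\ C(q,\gamma)A(\epsilon)\Big(1+\sum_{k=1}^m (t_k/v_k)^p\Big)^{-1/p}\right\},\qquad p:=\frac{q}{q-1},$$ with $C(q,\gamma)=4(2\gamma)^{1/q}$.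
   Context: The modulus of smoothness of $X$ is $\rho(u):=\sup_{\|x\|=\|y\|=1}\left(\frac{\|x+uy\|+\|x-uy\|}{2}-1\right)$; $X$ is uniformly smooth if $\lim_{u\to0}\rho(u)/u=0$. A dictionary in $X$ is a set $\mathcal{D}\subset X$ such that $\|g\|\le 1$ for every $g\in\mathcal{D}$, $g\in\mathcal{D}$ implies $-g\in\mathcal{D}$, and the closed linear span of $\mathcal{D}$ is $X$. $A_1^o(\mathcal{D}):=\{f\in X: f=\sum_{i=1}^\infty c_i g_i,\ g_i\in\mathcal{D},\ c_i\in\mathbb{R},\ \sum_{i=1}^\infty |c_i|\le 1\}$, and $A_1(\mathcal{D})$ is the closure of $A_1^o(\mathcal{D})$ in $X$. For $F\in X'$ (the dual space) put $\|F\|_{\mathcal{D}}:=\sup_{g\in\mathcal{D}}F(g)$. For nonzero $f\in X$, $F_f\in X'$ denotes a norming functional of $f$: $\|F_f\|=1$, $F_f(f)=\|f\|$. For a finite-dimensional subspace $\Phi\subset X$, $P_\Phi(x)$ denotes a best approximant to $x$ from $\Phi$ (Chebyshev projection). Weak Chebyshev Greedy Algorithm (WCGA) with weakness sequence $\tau=\{t_k\}_{k=1}^\infty$, $0\le t_k\le 1$: set $f^c_0=f^{c,\tau}_0:=f$ and $\Phi_0:=\{0\}$. For each $m\ge1$ (as long as $f^c_{m-1}\ne 0$; the algorithm stops once a residual is zero): 1) $\varphi^c_m\in\mathcal{D}$ is any element satisfying $F_{f^c_{m-1}}(\varphi^c_m)\ge t_m\|F_{f^c_{m-1}}\|_{\mathcal{D}}$;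 2) $\Phi_m:=\operatorname{span}\{\varphi^c_j\}_{j=1}^m$ and $G^c_m$ is a best approximant to $f$ from $\Phi_m$; 3) $f^c_m=f^{c,\tau}_m:=f-G^c_m$. Further, $v_m:=\|\varphi^c_m-P_{\Phi_{m-1}}(\varphi^c_m)\|$, i.e. the distance from $\varphi^c_m$ to $\Phi_{m-1}$. Convention: if $v_k=0$ (which can occur only when $t_k=0$), the term $t_k/v_k$ is understood to be $0$. *)

(* Defs.v *)
From HB Require Import structures.
From mathcomp Require Import all_boot all_order all_algebra.
From mathcomp Require Import all_classical all_reals all_analysis.

Set Implicit Arguments.
Unset Strict Implicit.
Unset Printing Implicit Defensive.

Import Order.TTheory GRing.Theory Num.Theory.
Import numFieldNormedType.Exports.

Local Open Scope classical_set_scope.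
Local Open Scope ring_scope.

(* All the real suprema below are taken over sets that are bounded above:
   by |u| for [smoothness_modulus], by the operator norm of a continuous linear F for
   [dual_norm] and [dict_norm]. The only sets that can be empty (if X = {0})
   are those of [smoothness_modulus] and [dict_norm]; [sup] is then 0. *)

Definition smoothness_modulus (R : realType) (X : normedModType R) (u : R) : R :=
  sup [set r | exists x y : X, [/\ `|x| = 1, `|y| = 1 &
    r = (`|x + u *: y| + `|x - u *: y|) / 2 - 1]].

Definition uniformly_smooth (R : realType) (X : normedModType R) : Prop :=
  smoothness_modulus X u / u @[u --> 0^'] --> (0 : R).

Definition lin_span (R : realType) (X : normedModType R) (A : set X) : set X :=
  [set x | exists n (c : 'I_n -> R) (g : 'I_n -> X),
    (forall i, A (g i)) /\ x = \sum_(i < n) c i *: g i].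

Record is_dictionary (R : realType) (X : normedModType R) (D : set X) : Prop :=
  IsDictionary {
    dictionary_norm_le1 : forall g, D g -> `|g| <= 1 ;
    dictionary_opp : forall g, D g -> D (- g) ;
    dictionary_dense : closure (lin_span D) = setT }.

Definition A1o (R : realType) (X : normedModType R) (D : set X) : set X :=
  [set f | exists (c : nat -> R) (g : nat -> X),
    [/\ forall i, D (g i),
        series (fun i => c i *: g i) @ \oo --> f &
        (\sum_(0 <= i <oo) `|c i|%:E <= 1)%E]].

Definition A1 (R : realType) (X : normedModType R) (D : set X) : set X :=
  closure (A1o D).

Definition dual_norm (R : realType) (X : normedModType R) (F : X -> R) : R :=
  sup [set `|F x| | x in [set x : X | `|x| <= 1]].

Definition dict_norm (R : realType) (X : normedModType R) (D : set X)
    (F : X -> R) : R :=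
  sup [set F g | g in D].

Definition norming_functional (R : realType) (X : normedModType R) (f : X)
    (F : {linear X -> R^o}) : Prop :=
  [/\ continuous F, dual_norm F = 1 & F f = `|f|].

Definition best_approximant (R : realType) (X : normedModType R) (Phi : set X)
    (x p : X) : Prop :=
  Phi p /\ forall y, Phi y -> `|x - p| <= `|x - y|.

(* The default value 0 of [xget] is never used for a finite-dimensional Phi,
   since a best approximant then exists. *)
Definition chebyshev_proj (R : realType) (X : normedModType R) (Phi : set X)
    (x : X) : X :=
  xget 0 [set p | best_approximant Phi x p].

(* Iterations are numbered from 1: [phi 0] is never used, and the space of
   index 0 is the span of the empty set, that is {0}. *)
Definition wcga_space (R : realType) (X : normedModType R) (phi : nat -> X)
    (m : nat) : set X :=
  lin_span [set phi j | j in [set j | (1 <= j <= m)%N]].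

(* At least N iterations of the algorithm applied to f have been performed,
   with residuals res, selected elements phi and approximants G; the entries
   of res, phi and G of index > N are unconstrained. *)
Record wcga_run (R : realType) (X : normedModType R) (D : set X) (t : nat -> R)
    (f : X) (res phi G : nat -> X) (N : nat) : Prop := WcgaRun {
  wcga_res0 : res 0 = f ;
  wcga_continue : forall m, (1 <= m <= N)%N -> res m.-1 != 0 ;
  wcga_select : forall m, (1 <= m <= N)%N ->
    D (phi m) /\
    exists2 F : {linear X -> R^o}, norming_functional (res m.-1) F &
      t m * dict_norm D F <= F (phi m) ;
  wcga_approx : forall m, (1 <= m <= N)%N ->
    best_approximant (wcga_space phi m) f (G m) ;
  wcga_res : forall m, (1 <= m <= N)%N -> res m = f - G m }.

Definition wcga_v (R : realType) (X : normedModType R) (phi : nat -> X)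
    (m : nat) : R :=
  `|phi m - chebyshev_proj (wcga_space phi m.-1) (phi m)|.

(* Main.v *)
Require Import Defs.
From HB Require Import structures.
From mathcomp Require Import all_boot all_order all_algebra.
From mathcomp Require Import all_classical all_reals all_analysis.
From mathcomp Require Import ring lra.
Import Order.TTheory GRing.Theory Num.Theory.
Import numFieldNormedType.Exports.
Local Open Scope classical_set_scope.
Local Open Scope ring_scope.
Set Implicit Arguments.
Unset Strict Implicit.
Unset Printing Implicit Defensive.

(** The norm of a space with a power-type modulus of smoothness is
    differentiable with a quantitative error, and its derivative at x is any
    norming functional F of x ([norm_sub_le_power]). Two consequences drive the
    proof. First, the norming functional of a residual vanishes on the space
    from which f has just been best approximated ([wcga_norming_vanishes]), so
    that F measures f alone: |f_{m-1}| = F f. As f is within eps of A times the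
    closed convex hull of D, on which F is at most its supremum |F|_D over D
    ([A1_le_dict_norm]), |F|_D is at least |f_{m-1}| / (2 A) as long as
    |f_{m-1}| >= 2 eps, and the weak greedy choice makes F (phi_m) at least
    t_m times this number. Second, the new residual is no larger than
    |f_{m-1} - l h| for every l, where h is phi_m minus its projection onto the
    previous space, so that F h = F (phi_m) while |h| = v_m. The expansion of
    the norm, optimized over l, yields
<<
      |f_m| <= |f_{m-1}| (1 - ((t_m / v_m) |f_{m-1}| / (C A))^p)
>>
    ([wcga_step]). With b_m = (|f_m| / (C A))^p this says that 1 / b_m grows at
    least by (t_m / v_m)^p at each step ([decay_recurrence]), and summing gives
    the rate. The sum starts from 1 / b_0 >= 1: the initial residual is at most
    2 A ([target_norm_le]), and C >= 2 because gamma is bounded below in every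
    nonzero space ([smoothness_const_ge]). Once some residual is at most 2 eps,
    all later ones are, since residuals do not increase. *)

(** * The scalar recurrence *)

(** Optimization of the step length. The minimum over mu of the right-hand
    side behaves like a power of s * a, and this is where the conjugate
    exponent q / (q - 1) and the constant 4 (2 gamma)^(1/q) come from: mu is
    chosen so that the smoothness error 2 gamma mu^q is half of the linear
    gain. *)
Lemma optimized_step (R : realType) (q gamma A a a' s : R) :
  1 < q -> 0 < gamma -> 0 < A -> 0 <= a -> 0 <= s ->
  (forall mu, 0 <= mu ->
     a' <= a * (1 - mu * s * a / (2 * A) + 2 * gamma * mu `^ q)) ->
  a' <= a * (1 - (s * a / (4 * (2 * gamma) `^ q^-1 * A)) `^ (q / (q - 1))).
Proof.
move=> q1 g0 A0 a0 s0 H.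
have q10 : q - 1 != 0 by rewrite gt_eqF // subr_gt0.
have q0 : q != 0 by rewrite gt_eqF // (lt_trans _ q1).
have A1 : A != 0 by rewrite gt_eqF.
have g1 : gamma != 0 by rewrite gt_eqF.
set p := q / (q - 1).
have pE : p = 1 + (q - 1)^-1 by rewrite /p; field.
have p0 : p != 0 by rewrite mulf_neq0 ?invr_neq0.
pose w := s * a / (8 * gamma * A).
have w0 : 0 <= w.
  by rewrite /w; apply: divr_ge0; rewrite !mulr_ge0 // ltW.
have muq : (w `^ (q - 1)^-1) `^ q = w `^ p.
  by rewrite -powRrM mulrC.
have muw : w * w `^ (q - 1)^-1 = w `^ p.
  rewrite pE powRD ?powRr1 //.
  by apply/implyP; rewrite -pE (negbTE p0).
have twog : 0 < 2 * gamma by rewrite mulr_gt0.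
set c := (2 * gamma) `^ q^-1.
have c0 : 0 < c by rewrite powR_gt0.
have eqw : (s * a / (4 * c * A)) `^ p = 2 * gamma * w `^ p.
  have -> : s * a / (4 * c * A) = (2 * gamma) `^ p^-1 * w.
    have -> : (2 * gamma) `^ p^-1 = 2 * gamma / c.
      rewrite /c -powRN -{2}[2 * gamma]powRr1 ?ltW // -powRD.
        by congr (_ `^ _); rewrite /p; field; rewrite q0.
      by apply/implyP => _; rewrite gt_eqF.
    rewrite /w; field; rewrite A1 g1 gt_eqF //.
  by rewrite powRM ?powR_ge0 // -powRrM mulVf // powRr1 // ltW.
apply: (le_trans (H (w `^ (q - 1)^-1) (powR_ge0 _ _))).
rewrite eqw muq -muw.
rewrite le_eqVlt; apply/orP; left; apply/eqP.
congr (a * _).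
have -> : w `^ (q - 1)^-1 * s * a / (2 * A) = 4 * gamma * (w * w `^ (q - 1)^-1).
  by rewrite /w; field; rewrite A1 g1.
ring.
Qed.

(** With b = (a / B)^p, the inequality (1 - x)^p <= 1 - x on [0, 1] turns the
    step into b' <= b (1 - s^p b), which heuristically reads 1/b' >= 1/b + s^p. The
    bound on 1/b is kept in the product form b T <= 1, so that vanishing
    residuals require no separate treatment. *)
Lemma decay_recurrence (R : realType) (p B a a' s T : R) :
  1 <= p -> 0 < B -> 0 <= a -> 0 <= a' -> 0 <= s -> 0 <= T ->
  a' <= a * (1 - (s * a / B) `^ p) ->
  (a / B) `^ p * T <= 1 ->
  (a' / B) `^ p * (T + s `^ p) <= 1.
Proof.
move=> p1 B0 a0 a'0 s0 T0 step hT.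
have p0 : 0 < p by apply: lt_le_trans p1.
set b := (a / B) `^ p in hT.
set sg := s `^ p.
have b0 : 0 <= b by apply: powR_ge0.
have sg0 : 0 <= sg by apply: powR_ge0.
have aB : 0 <= a / B by rewrite divr_ge0 // ltW.
have sbE : (s * a / B) `^ p = sg * b by rewrite -mulrA powRM.
rewrite sbE in step.
have [aZ|aN] := eqVneq a 0.
  have -> : a' = 0 by apply/eqP; rewrite eq_le a'0 (le_trans step) // aZ mul0r.
  by rewrite mul0r powR0 ?mul0r ?gt_eqF.
have ap : 0 < a by rewrite lt_neqAle eq_sym aN.
have x0 : 0 <= 1 - sg * b.
  by rewrite -(pmulr_rge0 _ ap) (le_trans a'0).
have x1 : 1 - sg * b <= 1 by rewrite lerBlDr lerDl mulr_ge0.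
have powx : (1 - sg * b) `^ p <= 1 - sg * b.
  have [xZ|xN] := eqVneq (1 - sg * b) 0; first by rewrite xZ powR0 ?gt_eqF.
  by apply: ge1r_powR => //; rewrite x1 andbT lt_neqAle eq_sym xN.
have step' : (a' / B) `^ p <= b * (1 - sg * b).
  apply: (@le_trans _ _ ((a / B * (1 - sg * b)) `^ p)).
    apply: ge0_ler_powR; rewrite ?nnegrE ?mulr_ge0 ?divr_ge0 ?invr_ge0
      ?(ltW B0) ?(ltW p0) //.
    by rewrite mulrAC ler_pM2r ?invr_gt0.
  by rewrite powRM // ler_wpM2l.
have TS : 0 <= T + sg by rewrite addr_ge0.
apply: (le_trans (ler_wpM2r TS step')).
have -> : b * (1 - sg * b) * (T + sg) = (1 - sg * b) * (b * T + sg * b) by ring.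
apply: (@le_trans _ _ ((1 - sg * b) * (1 + sg * b))).
  by rewrite ler_wpM2l // lerD2r.
by have := sqr_ge0 (sg * b); rewrite expr2 => h; lra.
Qed.

Lemma decay_bound_root (R : realType) (p B a T : R) :
  0 < p -> 0 < B -> 0 <= a -> 0 < T ->
  (a / B) `^ p * T <= 1 -> a <= B * T `^ (- p^-1).
Proof.
move=> p0 B0 a0 T0 H.
have aB : 0 <= a / B by rewrite divr_ge0 // ltW.
have pV : p * p^-1 = 1 by rewrite divff ?gt_eqF.
rewrite -ler_pdivrMl // mulrC.
rewrite -[leLHS]powRr1 // -pV powRrM.
have -> : T `^ (- p^-1) = (T^-1) `^ p^-1.
  by rewrite -[T^-1]powR_inv1 ?ltW // -powRrM mulN1r.
apply: ge0_ler_powR; rewrite ?nnegrE ?powR_ge0 ?invr_ge0 ?(ltW p0) ?(ltW T0) //.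
by rewrite -[leRHS]mul1r ler_pdivlMr.
Qed.

(** * Consequences of a power-type modulus of smoothness *)

Definition smooth_of_power_type (R : realType) (X : normedModType R)
    (q gamma : R) : Prop :=
  forall u : R, 0 < u -> smoothness_modulus X u <= gamma * u `^ q.

Lemma normrZV_neq0 (R : realType) (X : normedModType R) (x : X) :
  x != 0 -> `|(`|x|^-1 *: x)| = 1.
Proof. by move=> x0; rewrite normrZ normfV normr_id mulVf // normr_eq0. Qed.

Lemma le_smoothness_modulus (R : realType) (X : normedModType R) (u : R)
    (x y : X) : 0 < u -> `|x| = 1 -> `|y| = 1 ->
  (`|x + u *: y| + `|x - u *: y|) / 2 - 1 <= smoothness_modulus X u.
Proof.
move=> u0 x1 y1; apply: ub_le_sup; last by exists x, y.
exists u => _ [x' [y' [hx hy ->]]].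
have h1 : `|x' + u *: y'| <= 1 + u.
  by rewrite (le_trans (ler_normD _ _)) // normrZ hx hy mulr1 gtr0_norm.
have h2 : `|x' - u *: y'| <= 1 + u.
  by rewrite (le_trans (ler_normB _ _)) // normrZ hx hy mulr1 gtr0_norm.
lra.
Qed.

(** Taking both unit vectors equal and u = 2 gives rho(2) >= 1, so gamma cannot
    be too small. This makes the constant of the theorem at least 2, which the
    initial residual requires. *)
Lemma smoothness_const_ge (R : realType) (X : normedModType R) (q gamma : R)
    (x : X) : smooth_of_power_type X q gamma -> x != 0 -> 1 <= gamma * 2 `^ q.
Proof.
move=> hX x0; apply: le_trans (hX 2 _) => //.
have n1 : `|(`|x|^-1 *: x)| = 1.
  exact: normrZV_neq0.
apply: le_trans (le_smoothness_modulus _ n1 n1) => //.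
move: (_ *: x) n1 => z n1.
have -> : z + 2 *: z = 3 *: z.
  by rewrite -{1}[z]scale1r -scalerDl; congr (_ *: _); ring.
have -> : z - 2 *: z = (- 1) *: z.
  by rewrite -{1}[z]scale1r -scalerBl; congr (_ *: _); ring.
rewrite !normrZ n1 normrN1 ger0_norm // !mulr1; lra.
Qed.

Lemma norm_sum_le_power (R : realType) (X : normedModType R) (q gamma : R)
    (x y : X) : 0 < q -> smooth_of_power_type X q gamma -> x != 0 ->
  `|x + y| + `|x - y| <= 2 * `|x| * (1 + gamma * (`|y| / `|x|) `^ q).
Proof.
move=> q0 hX x0.
have [->|y0] := eqVneq y 0.
  by rewrite normr0 mul0r powR0 ?gt_eqF // subr0 addr0 mulr0 addr0 mulr1; lra.
have nx : 0 < `|x| by rewrite normr_gt0.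
have ny : 0 < `|y| by rewrite normr_gt0.
set u := `|y| / `|x|.
have u0 : 0 < u by rewrite divr_gt0.
have := le_trans (le_smoothness_modulus u0 (normrZV_neq0 x0)
  (normrZV_neq0 y0)) (hX u u0).
have -> : u *: (`|y|^-1 *: y) = `|x|^-1 *: y.
  by rewrite scalerA /u; congr (_ *: _); field; rewrite !gt_eqF.
rewrite -scalerDr -scalerBr !normrZ normfV normr_id -mulrDr => H.
have -> : `|x + y| + `|x - y| = `|x| * (`|x|^-1 * (`|x + y| + `|x - y|)).
  by rewrite mulrA divff ?gt_eqF // mul1r.
rewrite (mulrC 2) -mulrA ler_pM2l //; lra.
Qed.

(** The supremum defining [dual_norm] would be 0 over an unbounded set, so its
    being 1 already makes the operator norm of F a true upper bound. *)
Lemma norming_functional_le (R : realType) (X : normedModType R) (f : X)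
    (F : {linear X -> R^o}) (x : X) : norming_functional f F -> `|F x| <= `|x|.
Proof.
move=> [_ F1 _].
have ub : has_sup [set `|F x| | x in [set x : X | `|x| <= 1]].
  apply: contrapT => /sup_out; rewrite -/(dual_norm F) F1 => /eqP.
  by rewrite oner_eq0.
have [->|x0] := eqVneq x 0; first by rewrite linear0 !normr0.
have nx : 0 < `|x| by rewrite normr_gt0.
have : `|F (`|x|^-1 *: x)| <= 1.
  rewrite -F1; apply: (sup_upper_bound ub); exists (`|x|^-1 *: x) => //=.
  by rewrite normrZV_neq0.
by rewrite linearZ /= normrM normfV normr_id ler_pdivrMl // mulr1.
Qed.

(** First-order expansion of the norm: F is its derivative at x, with an error
    controlled by the modulus of smoothness. The upper bound for |x - y| comes
    from the lower bound F (x + y) <= |x + y|. *)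
Lemma norm_sub_le_power (R : realType) (X : normedModType R) (q gamma : R)
    (x y : X) (F : {linear X -> R^o}) :
  0 < q -> smooth_of_power_type X q gamma -> x != 0 ->
  norming_functional x F ->
  `|x - y| <= `|x| - F y + 2 * gamma * `|x| * (`|y| / `|x|) `^ q.
Proof.
move=> q0 hX x0 hF.
have := norm_sum_le_power y q0 hX x0.
have : F (x + y) <= `|x + y|.
  by apply: le_trans (norming_functional_le _ hF); apply: ler_norm.
have [_ _ Fx] := hF; rewrite linearD Fx /= => h1 h2.
have -> : 2 * gamma * `|x| * (`|y| / `|x|) `^ q =
   2 * `|x| * (gamma * (`|y| / `|x|) `^ q) by ring.
rewrite mulrDr mulr1 in h2.
set Z := _ * (gamma * _) in h2 *.
lra.
Qed.

(** The easy half of duality between best approximation and norming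
    functionals: if moving along y never decreases the norm, the first-order
    term F y cannot be positive, because it would beat the error of order l^q
    for small l. *)
Lemma norming_le0_of_orthogonal (R : realType) (X : normedModType R)
    (q gamma : R) (x y : X) (F : {linear X -> R^o}) :
  1 < q -> 0 < gamma -> smooth_of_power_type X q gamma -> x != 0 ->
  norming_functional x F ->
  (forall l : R, `|x| <= `|x - l *: y|) -> F y <= 0.
Proof.
move=> q1 g0 hX x0 hF orth; rewrite leNgt; apply/negP => Fy.
have q0 : 0 < q by apply: lt_trans q1.
have q10 : 0 < q - 1 by rewrite subr_gt0.
have nx : 0 < `|x| by rewrite normr_gt0.
set K := 2 * gamma * `|x| * (`|y| / `|x|) `^ q.
have K0 : 0 <= K by rewrite !mulr_ge0 ?powR_ge0 // ltW.
(* The step l below makes the error K l^(q-1) at most half of F y; adding 1 to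
   K avoids a division by zero when K vanishes. *)
set e := F y / (2 * (K + 1)).
have K1 : 0 < K + 1 by lra.
have e0 : 0 < e by rewrite divr_gt0 // mulr_gt0.
set l := e `^ (q - 1)^-1.
have l0 : 0 < l by rewrite powR_gt0.
have lq : l `^ q = l * e.
  have -> : q = 1 + (q - 1) by ring.
  rewrite powRD; last by apply/implyP => _; rewrite gt_eqF.
  rewrite powRr1 ?ltW //; congr (_ * _).
  by rewrite /l -powRrM mulVf ?powRr1 ?gt_eqF // ltW.
have := le_trans (orth l) (norm_sub_le_power (l *: y) q0 hX x0 hF).
rewrite linearZ /= normrZ gtr0_norm // -(mulrA l) powRM ?divr_ge0
  ?(ltW l0) // lq.
have -> : 2 * gamma * `|x| * (l * e * (`|y| / `|x|) `^ q) = l * (e * K).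
  by rewrite /K; ring.
have eK : e * (K + 1) = F y / 2.
  by rewrite /e; field; rewrite gt_eqF.
have eK2 : e * K = F y / 2 - e by rewrite -eK; ring.
rewrite eK2 -[l *: F y]/(l * F y) => h.
have : l * F y <= l * (F y / 2 - e) by lra.
rewrite ler_pM2l //; lra.
Qed.

(** * The closed convex hull of a dictionary *)

(** The facts used about A1 ([A1_norm_le1], [A1_le_dict_norm]) are closed
    conditions which hold on finite combinations, hence on limits of series
    and then on the closure. *)
Lemma A1_closed_ind (R : realType) (X : normedModType R) (D C : set X)
    (z : X) : closed C ->
  (forall (c : nat -> R) (g : nat -> X) n, (forall i, D (g i)) ->
     \sum_(0 <= i < n) `|c i| <= 1 -> C (\sum_(0 <= i < n) c i *: g i)) ->
  A1 D z -> C z.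
Proof.
move=> cC H; rewrite [C](closure_id _).1 //; apply: closureS => {}z.
move=> [c [g [Dg cvz sumc]]].
apply: (closed_cvg C cC _ z cvz); apply: nearW => n.
apply: H => //; rewrite -lee_fin -sumEFin; apply: le_trans sumc.
exact: (@nneseries_lim_ge R (fun i => `|c i|%:E) xpredT 0 n).
Qed.

Lemma A1_norm_le1 (R : realType) (X : normedModType R) (D : set X) (z : X) :
  is_dictionary D -> A1 D z -> `|z| <= 1.
Proof.
move=> hD; apply: (A1_closed_ind (C := [set x | `|x| <= 1])).
  have /continuous_closedP cN : continuous (Num.norm : X -> R).
    exact: norm_continuous.
  exact: cN _ (@closed_le R 1).
move=> c g n Dg sumc /=; apply: le_trans sumc.
apply: (le_trans (ler_norm_sum _ _ _)); apply: ler_sum => i _.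
by rewrite normrZ ler_piMr // (dictionary_norm_le1 hD).
Qed.

Lemma norming_le_dict_norm (R : realType) (X : normedModType R) (D : set X)
    (f g : X) (F : {linear X -> R^o}) :
  is_dictionary D -> norming_functional f F -> D g -> F g <= dict_norm D F.
Proof.
move=> hD hF Dg; apply: ub_le_sup; last by exists g.
exists 1 => _ [h Dh <-].
apply: (le_trans (ler_norm _)).
apply: (le_trans (norming_functional_le h hF)).
exact: dictionary_norm_le1 Dh.
Qed.

(** A linear functional is bounded on the hull by its supremum over D. The
    symmetry of D handles coefficients of either sign, and makes the
    supremum nonnegative. *)
Lemma A1_le_dict_norm (R : realType) (X : normedModType R) (D : set X)
    (f z : X) (F : {linear X -> R^o}) :
  is_dictionary D -> norming_functional f F -> A1 D z -> F z <= dict_norm D F.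
Proof.
move=> hD hF; apply: (A1_closed_ind (C := [set x | F x <= dict_norm D F])).
  have [/continuous_closedP cF _ _] := hF.
  exact: cF _ (@closed_le R (dict_norm D F)).
move=> c g n Dg sumc /=.
have Fg i : `|F (g i)| <= dict_norm D F.
  rewrite ler_norml lerNl -[- F (g i)](linearN F).
  rewrite !(norming_le_dict_norm hD hF) //.
  exact: dictionary_opp.
rewrite linear_sum.
apply: (@le_trans _ _ (\sum_(0 <= i < n) `|c i| * dict_norm D F)).
  apply: ler_sum => i _; rewrite linearZ /=.
  apply: (le_trans (ler_norm _)); rewrite normrM ler_wpM2l //.
rewrite -mulr_suml ler_piMl // (le_trans _ (Fg 0)) //.
Qed.

(** * The spaces and residuals of the algorithm *)

Lemma lin_span0 (R : realType) (X : normedModType R) (A : set X) :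
  lin_span A 0.
Proof.
by exists 0%N, (fun=> 0), (fun=> 0); split; [case | rewrite big_ord0].
Qed.

Lemma lin_span_gen (R : realType) (X : normedModType R) (A : set X) (x : X) :
  A x -> lin_span A x.
Proof.
by move=> Ax; exists 1%N, (fun=> 1), (fun=> x); rewrite big_ord1 scale1r.
Qed.

Lemma lin_spanZ (R : realType) (X : normedModType R) (A : set X) (a : R)
    (x : X) : lin_span A x -> lin_span A (a *: x).
Proof.
move=> [n [c [g [Ag ->]]]]; exists n, (fun i => a * c i), g; split=> //.
by rewrite scaler_sumr; apply: eq_bigr => i _; rewrite scalerA.
Qed.

Lemma lin_spanD (R : realType) (X : normedModType R) (A : set X) (x y : X) :
  lin_span A x -> lin_span A y -> lin_span A (x + y).
Proof.
move=> [n [c [g [Ag ->]]]] [n' [c' [g' [Ag' ->]]]].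
pose glue T (u : 'I_n -> T) (u' : 'I_n' -> T) (i : 'I_(n + n')) :=
  match fintype.split i with inl j => u j | inr j => u' j end.
exists (n + n')%N, (glue R c c'), (glue X g g'); split.
  by move=> i; rewrite /glue; case: fintype.split.
rewrite big_split_ord /=; congr (_ + _); apply: eq_bigr => i _.
  by rewrite /glue (unsplitK (inl _ i)).
by rewrite /glue (unsplitK (inr _ i)).
Qed.

Lemma lin_spanS (R : realType) (X : normedModType R) (A B : set X) :
  A `<=` B -> lin_span A `<=` lin_span B.
Proof.
by move=> AB x [n [c [g [Ag ->]]]]; exists n, c, g; split=> // i; exact: AB.
Qed.

Lemma wcga_spaceS (R : realType) (X : normedModType R) (phi : nat -> X) m n :
  (m <= n)%N -> wcga_space phi m `<=` wcga_space phi n.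
Proof.
move=> mn; apply: lin_spanS => _ [j /= /andP[j1 jm] <-].
by exists j => //=; rewrite j1 (leq_trans jm).
Qed.

(** Subtracting an element of the span from phi_m leaves its value under a
    functional vanishing there unchanged, so the difference, whose norm is
    [wcga_v], descends as well as phi_m. The default value 0 of the choice
    defining the projection also lies in the span. *)
Lemma chebyshev_proj_in (R : realType) (X : normedModType R) (A : set X)
    (x : X) : lin_span A (chebyshev_proj (lin_span A) x).
Proof.
by rewrite /chebyshev_proj; case: xgetP => [p _ []|_] //; exact: lin_span0.
Qed.

(** This is the invariant of the algorithm; it includes m = 0, where the
    space is {0}. *)
Lemma wcga_res_best (R : realType) (X : normedModType R) (D : set X)
    (t : nat -> R) (f : X) (res phi G : nat -> X) (N m : nat) :
  wcga_run D t f res phi G N -> (m <= N)%N ->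
  wcga_space phi m (f - res m) /\
  forall y, wcga_space phi m y -> `|res m| <= `|f - y|.
Proof.
move=> hrun; case: m => [_|m mN].
  rewrite (wcga_res0 hrun) subrr; split; first exact: lin_span0.
  move=> y [n [c [g [Ag ->]]]]; rewrite big1 ?subr0 // => i _.
  by have [j /= /andP[j1 j0]] := Ag i; rewrite leqNgt j1 in j0.
have mN' : (1 <= m.+1 <= N)%N by rewrite mN.
have [GP Gbest] := wcga_approx hrun mN'.
rewrite (wcga_res hrun mN'); split=> //.
by rewrite opprB addrC subrK.
Qed.

(** Since the spaces increase, the new residual competes against every
    correction of the previous residual within the new space. *)
Lemma wcga_norm_le (R : realType) (X : normedModType R) (D : set X)
    (t : nat -> R) (f : X) (res phi G : nat -> X) (N m : nat) (y : X) :
  wcga_run D t f res phi G N -> (m.+1 <= N)%N ->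
  wcga_space phi m.+1 y -> `|res m.+1| <= `|res m - y|.
Proof.
move=> hrun mN Py.
have [_ best] := wcga_res_best hrun mN.
have [Pm _] := wcga_res_best hrun (ltnW mN).
have -> : res m - y = f - ((f - res m) + y).
  by rewrite opprD opprB addrA (addrC f) subrK.
by apply: best; apply: lin_spanD => //; exact: wcga_spaceS Pm.
Qed.

(** Any norming functional of the residual, in particular the one selected by
    the run, annihilates the current space: for y and for - y,
    orthogonality of the residual gives F y <= 0. *)
Lemma wcga_norming_vanishes (R : realType) (X : normedModType R) (q gamma : R)
    (D : set X) (t : nat -> R) (f : X) (res phi G : nat -> X) (N m : nat)
    (F : {linear X -> R^o}) (y : X) :
  1 < q -> 0 < gamma -> smooth_of_power_type X q gamma ->
  wcga_run D t f res phi G N -> (m <= N)%N -> res m != 0 ->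
  norming_functional (res m) F -> wcga_space phi m y -> F y = 0.
Proof.
move=> q1 g0 hX hrun mN r0 hF Py.
have [Pm best] := wcga_res_best hrun mN.
suff le0 z : wcga_space phi m z -> F z <= 0.
  apply/eqP; rewrite eq_le le0 // -oppr_le0 -[- F y](linearN F) le0 //.
  by rewrite -scaleN1r; exact: lin_spanZ.
move=> Pz; apply: (norming_le0_of_orthogonal q1 g0 hX r0 hF) => l.
have -> : res m - l *: z = f - ((f - res m) + l *: z).
  by rewrite opprD opprB addrA (addrC f) subrK.
by apply: best; apply: lin_spanD => //; exact: lin_spanZ.
Qed.

(** The one-step decrease. As F annihilates the current space, F (phi_m) is
    unchanged when phi_m is replaced by its difference h with the projection,
    whose norm v_m may be much smaller: this is why t_m / v_m appears rather
    than t_m. The same annihilation gives |f_{m-1}| = F f <= A |F|_D + eps, so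
    2 eps <= |f_{m-1}| bounds |F|_D below. *)
Lemma wcga_step (R : realType) (X : normedModType R) (q gamma : R)
    (D : set X) (eps A : R) (t : nat -> R) (f feps : X)
    (res phi G : nat -> X) (N m : nat) :
  1 < q -> 0 < gamma -> smooth_of_power_type X q gamma -> is_dictionary D ->
  `|f - feps| <= eps -> 0 < A -> A1 D (A^-1 *: feps) ->
  wcga_run D t f res phi G N -> (m.+1 <= N)%N -> 0 <= t m.+1 ->
  2 * eps <= `|res m| ->
  `|res m.+1| <= `|res m| * (1 - (t m.+1 / wcga_v phi m.+1 * `|res m|
     / (4 * (2 * gamma) `^ q^-1 * A)) `^ (q / (q - 1))).
Proof.
move=> q1 g0 hX hD hf A0 hfe hrun mN t0 heps.
have q0 : 0 < q by apply: lt_trans q1.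
have mN' : (1 <= m.+1 <= N)%N by rewrite mN.
have r0 : res m != 0 := wcga_continue hrun mN'.
have nr : 0 < `|res m| by rewrite normr_gt0.
have [Dphi [F hF tF]] := wcga_select hrun mN'; rewrite [res _]/= in hF.
have F0 := wcga_norming_vanishes q1 g0 hX hrun (ltnW mN) r0 hF.
have [Pm _] := wcga_res_best hrun (ltnW mN).
have [_ _ Fr] := hF.
have dnF : `|res m| / (2 * A) <= dict_norm D F.
  have h1 : F (feps) <= A * dict_norm D F.
    have := A1_le_dict_norm hD hF hfe.
    by rewrite linearZ /= ler_pdivrMl.
  have h2 : F (f - feps) <= eps.
    apply: le_trans hf; apply: le_trans (norming_functional_le _ hF).
    exact: ler_norm.
  have h3 : F (f - res m) = 0 := F0 _ Pm.
  have h4 : F f = F feps + F (f - feps) by rewrite linearB /= addrC subrK.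
  rewrite linearB /= Fr in h3.
  by rewrite ler_pdivrMr ?mulr_gt0 //; lra.
have Fphi : t m.+1 * `|res m| / (2 * A) <= F (phi m.+1).
  by apply: le_trans tF; rewrite -mulrA ler_wpM2l.
pose P := chebyshev_proj (wcga_space phi m) (phi m.+1).
have PP : wcga_space phi m P by exact: chebyshev_proj_in.
pose h := phi m.+1 - P.
have hv : wcga_v phi m.+1 = `|h| by [].
have Fh : F h = F (phi m.+1) by rewrite linearB /= (F0 _ PP) subr0.
have Ph : wcga_space phi m.+1 h.
  apply: lin_spanD; last first.
    by rewrite -scaleN1r; apply: lin_spanZ; exact: wcga_spaceS PP.
  by apply: lin_span_gen; exists m.+1 => //=; rewrite leqnn.
rewrite hv; apply: optimized_step => //.
  by rewrite divr_ge0.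
move=> mu mu0; set v := `|h|.
(* For v = 0 the quotient t / v is 0, there is no linear gain, and it is enough
   that the residuals do not increase. *)
have [v0|vN] := eqVneq v 0.
  rewrite v0 invr0 mulr0 mulr0 !mul0r subr0.
  have := wcga_norm_le hrun mN (lin_span0 _); rewrite subr0 => /le_trans; apply.
  by rewrite ler_peMr // lerDl !mulr_ge0 ?powR_ge0 // ltW.
have vp : 0 < v by rewrite lt_neqAle eq_sym vN normr_ge0.
(* Scaled so that the relative size lam * v / |f_{m-1}| of the correction
   is mu. *)
set lam := mu * `|res m| / v.
have lam0 : 0 <= lam by rewrite divr_ge0 ?mulr_ge0 // ltW.
apply: (le_trans (wcga_norm_le hrun mN (lin_spanZ lam Ph))).
apply: (le_trans (norm_sub_le_power (lam *: h) q0 hX r0 hF)).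
rewrite linearZ /= Fh normrZ (ger0_norm lam0) -/v.
have -> : lam * v / `|res m| = mu by rewrite /lam; field; rewrite vN gt_eqF.
have -> : `|res m| * (1 - mu * (t m.+1 / v) * `|res m| / (2 * A) +
     2 * gamma * mu `^ q) = `|res m| - lam * (t m.+1 * `|res m| / (2 * A)) +
     2 * gamma * `|res m| * mu `^ q.
  by rewrite /lam; field; rewrite vN gt_eqF.
by rewrite lerD2r lerD2l lerN2 ler_wpM2l.
Qed.

(** * The rate of convergence *)

(** The initial residual: when eps is at most half of |f|, the element feps
    of norm at most A carries at least half of the norm of f. *)
Lemma target_norm_le (R : realType) (X : normedModType R) (D : set X)
    (eps A : R) (f feps : X) :
  is_dictionary D -> `|f - feps| <= eps -> 0 < A -> A1 D (A^-1 *: feps) ->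
  2 * eps <= `|f| -> `|f| <= 2 * A.
Proof.
move=> hD hf A0 hfe he.
have h1 : `|feps| <= A.
  have := A1_norm_le1 hD hfe.
  by rewrite normrZ normfV gtr0_norm // ler_pdivrMl // mulr1.
have := ler_normD (f - feps) feps; rewrite subrK; lra.
Qed.

Lemma smoothness_const_root_ge (R : realType) (q gamma : R) :
  1 < q -> 0 < gamma -> 1 <= gamma * 2 `^ q -> 2^-1 <= (2 * gamma) `^ q^-1.
Proof.
move=> q1 g0 h.
have q0 : 0 < q by apply: lt_trans q1.
have p2 : 0 < 2 `^ q :> R by rewrite powR_gt0.
have -> : 2^-1 = ((2^-1) `^ q) `^ q^-1 :> R.
  by rewrite -powRrM divff ?powRr1 ?gt_eqF // invr_ge0.
apply: ge0_ler_powR; rewrite ?nnegrE ?powR_ge0 ?invr_ge0 ?mulr_ge0 ?(ltW g0)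
  ?(ltW q0) //.
have -> : (2^-1) `^ q = (2 `^ q)^-1 :> R.
  by rewrite -[2^-1]powR_inv1 // -powRrM mulN1r powRN.
rewrite -[_^-1]mul1r ler_pdivrMr // (le_trans h) // ler_pM2r //.
lra.
Qed.

(* In MathComp x / 0 = 0, which is the convention for t_k / v_k when v_k = 0. *)
Theorem theorem1p3 (R : realType) (X : completeNormedModType R)
    (q gamma : R) (hq1 : 1 < q) (hq2 : q <= 2) (hgamma : 0 < gamma)
    (hX : uniformly_smooth X)
    (hrho : forall u : R, 0 < u -> smoothness_modulus X u <= gamma * u `^ q)
    (D : set X) (hD : is_dictionary D)
    (eps : R) (heps : 0 <= eps) (f feps : X) (hf : `|f - feps| <= eps)
    (A : R) (hA : 0 < A) (hfeps : A1 D (A^-1 *: feps))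
    (t : nat -> R) (ht : forall k, (1 <= k)%N -> 0 <= t k <= 1)
    (res phi G : nat -> X) (N : nat) (hrun : wcga_run D t f res phi G N)
    (m : nat) (hm1 : (1 <= m)%N) (hmN : (m <= N)%N) :
  let p := q / (q - 1) in
  let C := 4 * (2 * gamma) `^ q^-1 in
  `|res m| <= Num.max (2 * eps)
    (C * A * (1 + \sum_(1 <= k < m.+1) (t k / wcga_v phi k) `^ p) `^ (- p^-1)).
Proof.
cbv zeta; set p := q / (q - 1); set C := 4 * (2 * gamma) `^ q^-1.
have q0 : 0 < q by apply: lt_trans hq1.
have q10 : 0 < q - 1 by rewrite subr_gt0.
have p1 : 1 <= p by rewrite /p ler_pdivlMr // mul1r; lra.
have p0 : 0 < p by apply: lt_le_trans p1.
have f0 : f != 0.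
  rewrite -(wcga_res0 hrun); apply: (wcga_continue hrun (m := 1)).
  by rewrite (leq_trans hm1 hmN).
have C2 : 2 <= C.
  have := smoothness_const_root_ge hq1 hgamma (smoothness_const_ge hrho f0).
  rewrite /C; lra.
have B0 : 0 < C * A by rewrite mulr_gt0 // (lt_le_trans _ C2).
pose T n := 1 + \sum_(1 <= k < n.+1) (t k / wcga_v phi k) `^ p.
have T0 n : 0 < T n.
  by rewrite ltr_pwDl // sumr_ge0 // => k _; exact: powR_ge0.
rewrite -/(T m).
(* The product form of the decay bound survives the induction; the root is
   taken at the end. *)
suff H n : (n <= N)%N ->
    `|res n| <= 2 * eps \/ (`|res n| / (C * A)) `^ p * T n <= 1.
  rewrite le_max; apply/orP; case: (H m hmN) => [|h]; [by left | right].
  exact: decay_bound_root h.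
elim: n => [_|n IH nN].
  rewrite (wcga_res0 hrun).
  have [|he] := leP `|f| (2 * eps); [by left | right].
  have := target_norm_le hD hf hA hfeps (ltW he) => fA.
  rewrite /T big_geq // addr0 mulr1.
  have oneE : 1 = 1 `^ p by rewrite powR1.
  rewrite [leRHS]oneE.
  apply: ge0_ler_powR; rewrite ?nnegrE ?(divr_ge0 (normr_ge0 f) (ltW B0))
    ?(ltW p0) //.
  rewrite ler_pdivrMr // mul1r (le_trans fA) // ler_pM2r //.
have mono : `|res n.+1| <= `|res n|.
  by have := wcga_norm_le hrun nN (lin_span0 _); rewrite subr0.
have [hn|hn] := leP `|res n| (2 * eps); first by left; exact: le_trans hn.
case: (IH (ltnW nN)) => [|bound]; first by rewrite leNgt hn.
right; rewrite /T big_nat_recr // addrA.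
have tn : 0 <= t n.+1 by case/andP: (ht n.+1 isT).
apply: (decay_recurrence p1 B0 (normr_ge0 (res n)) (normr_ge0 _) _
  (ltW (T0 n)) _ bound).
  by rewrite divr_ge0 // normr_ge0.
exact: wcga_step hq1 hgamma hrho hD hf hA hfeps hrun nN tn (ltW hn).
Qed.
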